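(* Let $k\ge 1$ be an integer and $\theta = 2\pi/(4k+4)$. Let $P$ be a finite set of points in general position and $S$ a set of constraints on $P$. Let $u,w\in P$ be two vertices such that $u$ can see $w$, let $m$ be the midpoint of the side of the canonical triangle $T_{uw}$ opposite $u$, and let $\alpha$ be the unsigned angle between $uw$ and $um$. Then there exists a path connecting $u$ and $w$ in the constrained $\theta_{(4k+4)}$-graph of $P$ with respect to $S$ of length at most \[\left( \frac{\cos \alpha}{\cos \left(\frac{\theta}{2}\right)} + \frac{\cos \alpha \cdot \tan \left(\frac{\theta}{2}\right) + \sin \alpha}{\cos \left(\frac{\theta}{2}\right) - \sin \left(\frac{\theta}{2}\right)} \right) \cdot |u w|.\]
   Context: $P$ is a finite set of points in the plane and $S$ is a set of line segments (called constraints), each joining two points of $P$, such that no two constraints intersect properly. Two points $u,v\in P$ can see each other if and only if the segment $uv$ does not properly intersect any constraint or $uv$ is itself a constraint. Fix an integer $k\ge 1$, $x\in\{2,3,4,5\}$ and $\theta=2\pi/(4k+x)$. Around each point $u$, the $4k+x$ rays from $u$ with angle $\theta$ between consecutive rays define cones; they are oriented so that the bisector of one cone, $C_0^u$, is the vertical half-line above $u$, and the cones are numbered $C_0^u, C_1^u, \dots$ clockwise; all points use the same orientation. For every constraint $uv$ with $v\in C_i^u$, the line through that constraint splits $C_i^u$; the resulting pieces are the subcones of $C_i^u$ (if a constraint $uv$ splits a cone of $u$ into two subcones, $v$ is considered to lie in both; a cone not split is a single subcone). The constrained $\theta_{(4k+x)}$-graph has vertex set $P$ and, for each vertex $u$ and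 each subcone of each cone $C_i^u$, an edge between $u$ and the vertex $v$ of that subcone that can see $u$ and whose orthogonal projection onto the bisector of the full cone $C_i^u$ (not of the subcone) is closest to $u$ among all vertices of that subcone that can see $u$. Edges are weighted by Euclidean length, and the length of a path is the sum of its edge lengths. General position: no two points lie on a line parallel to one of the rays defining the cones, no two points lie on a line perpendicular to the bisector of a cone, and no three points are collinear. For a vertex $w$ in cone $C_i^u$, the canonical triangle $T_{uw}$ is the triangle bounded by the two boundary rays of $C_i^u$ and the line through $w$ perpendicular to the bisector of $C_i^u$. *)

(* Defs.v *)
From Stdlib Require Import Reals Lra List.
Open Scope R_scope.

Definition pt := (R * R)%type.

Definition vsub (p q : pt) : pt := (fst p - fst q, snd p - snd q).
Definition vadd (p q : pt) : pt := (fst p + fst q, snd p + snd q).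
Definition vscale (a : R) (p : pt) : pt := (a * fst p, a * snd p).
Definition dot (p q : pt) : R := fst p * fst q + snd p * snd q.
Definition cross (p q : pt) : R := fst p * snd q - snd p * fst q.
Definition vnorm (p : pt) : R := sqrt (dot p p).
Definition edist (p q : pt) : R := vnorm (vsub q p).

Definition vangle (a b : pt) : R := acos (dot a b / (vnorm a * vnorm b)).

Definition midpoint (p q : pt) : pt := vscale (1/2) (vadd p q).

(* unit vector making (clockwise) angle t with the upward vertical *)
Definition cw_dir (t : R) : pt := (sin t, cos t).

Definition cone_angle (n : nat) : R := 2 * PI / INR n.

(* bisector direction of cone C_i (cone 0 bisected by the upward vertical,
   numbering clockwise) *)
Definition bisector (n i : nat) : pt := cw_dir (INR i * cone_angle n).

Definition bnd_dir1 (n i : nat) : pt := cw_dir (INR i * cone_angle n - cone_angle n / 2).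
Definition bnd_dir2 (n i : nat) : pt := cw_dir (INR i * cone_angle n + cone_angle n / 2).

Definition ray_dir (n j : nat) : pt := cw_dir ((INR j + 1/2) * cone_angle n).

(* v lies in the (open) cone C_i^u : the angle between v - u and the
   bisector is less than theta/2.  Boundary points are excluded by general
   position. *)
Definition in_cone (n : nat) (u : pt) (i : nat) (v : pt) : Prop :=
  dot (vsub v u) (bisector n i) > vnorm (vsub v u) * cos (cone_angle n / 2).

Definition proj (n : nat) (u : pt) (i : nat) (v : pt) : R :=
  dot (vsub v u) (bisector n i).

Definition is_constraint (S : list (pt * pt)) (a b : pt) : Prop :=
  In (a, b) S \/ In (b, a) S.

Definition proper_cross (a b c d : pt) : Prop :=
  cross (vsub b a) (vsub c a) * cross (vsub b a) (vsub d a) < 0 /\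
  cross (vsub d c) (vsub a c) * cross (vsub d c) (vsub b c) < 0.

Definition sees (S : list (pt * pt)) (u v : pt) : Prop :=
  (forall c : pt * pt, In c S -> ~ proper_cross u v (fst c) (snd c))
  \/ is_constraint S u v.

Definition general_position (n : nat) (P : list pt) : Prop :=
  (forall p q, In p P -> In q P -> p <> q ->
     (forall j, (j < n)%nat -> cross (ray_dir n j) (vsub q p) <> 0) /\
     (forall i, (i < n)%nat -> dot (bisector n i) (vsub q p) <> 0)) /\
  (forall p q r, In p P -> In q P -> In r P -> p <> q -> p <> r -> q <> r ->
     cross (vsub q p) (vsub r p) <> 0).

Definition valid_constraints (P : list pt) (S : list (pt * pt)) : Prop :=
  (forall c, In c S -> In (fst c) P /\ In (snd c) P /\ fst c <> snd c) /\
  (forall c1 c2, In c1 S -> In c2 S ->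
     ~ proper_cross (fst c1) (snd c1) (fst c2) (snd c2)).

(* Subcones.  The constraints u c with c in C_i^u split C_i^u by the rays u c.
   Choosing for every such c a closed side of the line through u c
   (side s c = true: cross (c - u) (x - u) >= 0, false: <= 0) and
   intersecting with C_i^u yields either the empty set or exactly one
   subcone; every subcone arises this way.  Points on a splitting ray lie in
   both adjacent subcones. *)
Definition in_subcone (n : nat) (S : list (pt * pt)) (u : pt) (i : nat)
    (side : pt -> bool) (x : pt) : Prop :=
  in_cone n u i x /\
  forall c, is_constraint S u c -> in_cone n u i c ->
    if side c then cross (vsub c u) (vsub x u) >= 0
    else cross (vsub c u) (vsub x u) <= 0.

Definition selects (n : nat) (P : list pt) (S : list (pt * pt)) (u v : pt) : Prop :=
  In v P /\
  exists i, (i < n)%nat /\ exists side : pt -> bool,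
    in_subcone n S u i side v /\ sees S u v /\
    forall w, In w P -> in_subcone n S u i side w -> sees S u w ->
      proj n u i v <= proj n u i w.

Definition theta_edge (n : nat) (P : list pt) (S : list (pt * pt)) (u v : pt) : Prop :=
  In u P /\ In v P /\ (selects n P S u v \/ selects n P S v u).

Fixpoint is_path (E : pt -> pt -> Prop) (x : pt) (l : list pt) (y : pt) : Prop :=
  match l with
  | nil => x = y
  | z :: l' => E x z /\ is_path E z l' y
  end.

Fixpoint path_length (x : pt) (l : list pt) : R :=
  match l with
  | nil => 0
  | z :: l' => edist x z + path_length z l'
  end.

(* canonical triangle T_uw for w in C_i^u: apex u, the other two corners are
   where the boundary rays meet the line through w perpendicular to the
   bisector. *)
Definition canon_corner1 (n : nat) (u : pt) (i : nat) (w : pt) : pt :=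
  vadd u (vscale (proj n u i w / cos (cone_angle n / 2)) (bnd_dir1 n i)).
Definition canon_corner2 (n : nat) (u : pt) (i : nat) (w : pt) : pt :=
  vadd u (vscale (proj n u i w / cos (cone_angle n / 2)) (bnd_dir2 n i)).
Definition canon_mid (n : nat) (u : pt) (i : nat) (w : pt) : pt :=
  midpoint (canon_corner1 n u i w) (canon_corner2 n u i w).

(* Main.v *)
(** For [n = 4k+4] the claimed bound is [c * (p + |q|)], where [p] and [q] are the coordinates of
    [w - u] along and across the bisector of the cone and [c = 1 / (cos (theta/2) - sin (theta/2))]:
    a multiple of the 1-norm in the frame of the cone. Since [4] divides [n], every coordinate axis
    of such a frame is itself a bisector, so the frame of the cone containing a vector is the one
    minimising its 1-norm.

    Induct on this 1-norm. Let [v] be the vertex selected by [u] in the subcone of [w] and [x] the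
    point of [uw] with the same projection as [v]. All vertices in the triangle [uvw] lie in the
    triangle [vxw], and the convex hull of those vertices yields a convex chain of visibility edges
    from [v] to [w], whose length in any seminorm is at most that of [v x w]. Measured in the
    1-norm of the frame of [u], the detour through [x] leaves room for [|uv| / c], so the
    induction hypothesis applies to every edge of the chain. *)

Require Import Defs.
From Stdlib Require Import Reals List Lra Lia Classical.
Open Scope R_scope.

(** * Orientation of triples and proper crossings *)

Definition orient (a b c : pt) : R := cross (vsub b a) (vsub c a).

(** Used with [v], [u], [w] in counterclockwise order, where it describes the open triangle. *)
Definition in_triangle (u v w q : pt) : Prop :=
  0 < orient v u q /\ 0 < orient u w q /\ 0 < orient w v q.

Definition uncrossed (S : list (pt * pt)) (a b : pt) : Prop :=
  forall c, In c S -> ~ proper_cross a b (fst c) (snd c).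

Definition interp (t : R) (a b : pt) : pt := vadd (vscale (1 - t) a) (vscale t b).

Ltac coords :=
  repeat match goal with x : pt |- _ => destruct x end;
  unfold interp, orient, proper_cross, cross, dot, vsub, vadd, vscale in *; cbn [fst snd] in *.

Lemma orient_interp (x y a b : pt) (t : R) :
  orient x y (interp t a b) = (1 - t) * orient x y a + t * orient x y b.
Proof. coords; ring. Qed.

(** The three orientations on the right are the unnormalised barycentric coordinates of [x] in [u],
    [v], [w], and [orient c d] is affine. *)
Lemma orient_barycentric (u v w c d x : pt) :
  orient v u w * orient c d x =
  orient w v x * orient c d u + orient u w x * orient c d v + orient v u x * orient c d w.
Proof. coords; ring. Qed.

Lemma orient_sum (u v w x : pt) :
  orient v u w = orient w v x + orient u w x + orient v u x.
Proof. coords; ring. Qed.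

Lemma orient_swap (a b c : pt) : orient b a c = - orient a b c.
Proof. coords; ring. Qed.

Lemma orient_cycle (a b c : pt) : orient b c a = orient a b c.
Proof. coords; ring. Qed.

Lemma orient_diag_l (a b : pt) : orient a b a = 0.
Proof. coords; ring. Qed.

Lemma orient_diag_r (a b : pt) : orient a b b = 0.
Proof. coords; ring. Qed.

Lemma proper_cross_orient (a b c d : pt) :
  proper_cross a b c d <->
  orient a b c * orient a b d < 0 /\ orient c d a * orient c d b < 0.
Proof. reflexivity. Qed.

Lemma proper_cross_swap_l (a b c d : pt) : proper_cross a b c d -> proper_cross b a c d.
Proof.
  rewrite !proper_cross_orient, !(orient_swap a b); intros [H1 H2]; split; lra.
Qed.

Lemma proper_cross_swap_r (a b c d : pt) : proper_cross a b c d -> proper_cross a b d c.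
Proof.
  rewrite !proper_cross_orient, !(orient_swap c d); intros [H1 H2]; split; lra.
Qed.

Lemma opposite_signs_interp (x y : R) :
  x * y < 0 -> exists t, 0 < t < 1 /\ (1 - t) * x + t * y = 0.
Proof.
  intros H. assert (Hn : x - y <> 0) by nra.
  exists (x / (x - y)). split; [|field; exact Hn].
  (* Over a square denominator, both bounds follow without a case split on the sign of [x]. *)
  assert (E : x / (x - y) = x * (x - y) / ((x - y) * (x - y))) by (field; exact Hn).
  assert (0 < (x - y) * (x - y)) by nra.
  rewrite E; split.
  - apply Rdiv_lt_0_compat; nra.
  - apply (Rmult_lt_reg_r ((x - y) * (x - y))); [assumption|].
    unfold Rdiv. rewrite Rmult_assoc, Rinv_l; nra.
Qed.

Lemma cross_pair_injective (a b e f : pt) :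
  cross a b <> 0 -> cross a e = cross a f -> cross b e = cross b f -> e = f.
Proof.
  destruct a as [ax ay], b as [bx b2], e as [ex ey], f as [fx fy].
  unfold cross; cbn [fst snd]. intros Hn Ha Hb.
  f_equal; apply (Rmult_eq_reg_l (ax * b2 - ay * bx)); try exact Hn.
  - replace ((ax * b2 - ay * bx) * ex)
      with (bx * (ax * ey - ay * ex) - ax * (bx * ey - b2 * ex)) by ring.
    rewrite Ha, Hb; ring.
  - replace ((ax * b2 - ay * bx) * ey)
      with (b2 * (ax * ey - ay * ex) - ay * (bx * ey - b2 * ex)) by ring.
    rewrite Ha, Hb; ring.
Qed.

(** The zero of [orient a b] on [cd] and the zero of [orient c d] on [ab] both lie on both lines;
    these are not parallel, so the two zeros coincide. *)
Lemma proper_cross_point (a b c d : pt) :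
  proper_cross a b c d ->
  exists s t, 0 < s < 1 /\ 0 < t < 1 /\ interp s a b = interp t c d.
Proof.
  rewrite proper_cross_orient. intros [H1 H2].
  destruct (opposite_signs_interp _ _ H1) as [t [Ht Et]].
  destruct (opposite_signs_interp _ _ H2) as [s [Hs Es]].
  exists s, t. split; [exact Hs|]. split; [exact Ht|].
  assert (Hn : orient a b c - orient a b d <> 0) by nra.
  rewrite <- orient_interp in Et, Es.
  apply (cross_pair_injective (vsub b a) (vsub d c)).
  - intro H; apply Hn; revert H; clear; coords; lra.
  - transitivity (cross (vsub b a) a); revert Et; clear; coords; lra.
  - transitivity (cross (vsub d c) c); revert Es; clear; coords; lra.
Qed.

(** Real-number core of [endpoint_in_triangle]: [ou], [ov], [ow] stand for [orient c d] at the
    corners, [g1], [g2], [g3] for the barycentric coordinates belonging to [w], [v], [u], taken at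
    [c], at [d] and at a point [z] of [cd]. *)
Lemma endpoint_signs (ou ov ow g1c g1d g1z g2c g2d g2z g3d g3z t : R) :
  0 < ou -> 0 < t < 1 ->
  g1z = (1 - t) * g1c + t * g1d -> g2z = (1 - t) * g2c + t * g2d ->
  g3z * ou + g2z * ov + g1z * ow = 0 ->
  g3d * ou + g2d * ov + g1d * ow = 0 ->
  ~ (g1c * g1d < 0 /\ ou * ov < 0) -> ~ (g2c * g2d < 0 /\ ou * ow < 0) ->
  0 < g1z -> 0 < g2z -> 0 <= g3z -> 0 < g3d -> g1d <> 0 -> g2d <> 0 ->
  0 < g1d /\ 0 < g2d.
Proof.
  intros Hou Ht E1 E2 Ez Ed N1 N2 P1 P2 P3 P3d Z1 Z2.
  (* If [d] is beyond the line [uv], then [cd] crosses that line; as [uv] itself is not properly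
     crossed, [v] is not separated from [u] by the line [cd]. [W] is the same for [uw]. *)
  assert (V : g1d < 0 -> 0 <= ov).
  { intros Hd. destruct (Rlt_le_dec ov 0) as [Hv|Hv]; [|exact Hv].
    exfalso; apply N1; split; [|nra]. assert (0 < g1c) by nra. nra. }
  assert (W : g2d < 0 -> 0 <= ow).
  { intros Hd. destruct (Rlt_le_dec ow 0) as [Hv|Hv]; [|exact Hv].
    exfalso; apply N2; split; [|nra]. assert (0 < g2c) by nra. nra. }
  assert (Hz : 0 <= g3z * ou) by nra.
  assert (Hd : 0 < g3d * ou) by nra.
  (* The line [cd] contains [z], so it must separate [u] from [v] or from [w]. *)
  assert (B : ov < 0 \/ ow < 0).
  { destruct (Rlt_le_dec ov 0); [now left|]. destruct (Rlt_le_dec ow 0); [now right|].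
    exfalso. assert (g2z * ov = 0) by nra. assert (g1z * ow = 0) by nra.
    assert (ov = 0) by nra. assert (ow = 0) by nra. subst ov ow. lra. }
  destruct (Rlt_le_dec g1d 0) as [H1|H1]; destruct (Rlt_le_dec g2d 0) as [H2|H2].
  - exfalso. specialize (V H1); specialize (W H2). lra.
  - exfalso. specialize (V H1). assert (ow < 0) by lra. nra.
  - exfalso. specialize (W H2). assert (ov < 0) by lra. nra.
  - lra.
Qed.

(* The segment [cd] meets the triangle, cannot leave it through [uv] or [uw],
   and [d] is on the inner side of [vw]. *)
Lemma endpoint_in_triangle (u v w c d : pt) (t : R) :
  0 < orient v u w -> 0 < t < 1 ->
  ~ proper_cross u v c d -> ~ proper_cross u w c d -> orient c d u <> 0 ->
  0 < orient v u (interp t c d) -> 0 < orient u w (interp t c d) ->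
  0 <= orient w v (interp t c d) ->
  0 < orient w v d -> orient v u d <> 0 -> orient u w d <> 0 ->
  in_triangle u v w d.
Proof.
  intros HD Ht N1 N2 Hu P1 P2 P3 P3d Z1 Z2.
  assert (Ez := orient_barycentric u v w c d (interp t c d)).
  assert (Ed := orient_barycentric u v w c d d).
  rewrite orient_diag_r, Rmult_0_r in Ed.
  replace (orient c d (interp t c d)) with 0 in Ez
    by (rewrite orient_interp, orient_diag_l, orient_diag_r; ring).
  rewrite Rmult_0_r in Ez.
  assert (E1 := orient_interp v u c d t). assert (E2 := orient_interp u w c d t).
  rewrite proper_cross_orient, !(orient_swap v u) in N1.
  rewrite proper_cross_orient in N2.
  enough (0 < orient v u d /\ 0 < orient u w d) by (unfold in_triangle; tauto).
  destruct (Rlt_le_dec 0 (orient c d u)) as [H|H].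
  - apply (endpoint_signs (orient c d u) (orient c d v) (orient c d w)
      (orient v u c) (orient v u d) (orient v u (interp t c d))
      (orient u w c) (orient u w d) (orient u w (interp t c d))
      (orient w v d) (orient w v (interp t c d)) t); try assumption; lra.
  - apply (endpoint_signs (- orient c d u) (- orient c d v) (- orient c d w)
      (orient v u c) (orient v u d) (orient v u (interp t c d))
      (orient u w c) (orient u w d) (orient u w (interp t c d))
      (orient w v d) (orient w v (interp t c d)) t); try assumption; lra.
Qed.

(** * Finite lists *)

Lemma list_argmin (A : Type) (l : list A) (Q : A -> Prop) (f : A -> R) :
  (exists x, In x l /\ Q x) ->
  exists x, In x l /\ Q x /\ forall y, In y l -> Q y -> f x <= f y.
Proof.
  induction l as [|a l IH]; intros [x [Hx HQ]]; [destruct Hx|].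
  destruct (classic (exists x, In x l /\ Q x)) as [He|He].
  - destruct (IH He) as [m [Hm [Qm Hmin]]].
    destruct (classic (Q a /\ f a <= f m)) as [[Qa Ha]|Ha].
    + exists a. split; [now left|]. split; [exact Qa|].
      intros y [<-|Hy] Qy; [lra|]. specialize (Hmin y Hy Qy). lra.
    + exists m. split; [now right|]. split; [exact Qm|].
      intros y [<-|Hy] Qy; [|now apply Hmin].
      destruct (Rle_lt_dec (f a) (f m)); [exfalso; tauto|lra].
  - exists x. split; [exact Hx|]. split; [exact HQ|].
    intros y [<-|Hy] Qy; [|exfalso; eauto].
    destruct Hx as [<-|Hx]; [lra|exfalso; eauto].
Qed.

Lemma filter_length_lt (A : Type) (f g : A -> bool) (l : list A) (p : A) :
  (forall x, f x = true -> g x = true) -> In p l -> f p = false -> g p = true ->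
  (length (filter f l) < length (filter g l))%nat.
Proof.
  intros Hfg Hp Fp Gp.
  assert (Hle : forall l', (length (filter f l') <= length (filter g l'))%nat).
  { induction l' as [|a l' IH]; cbn; [lia|].
    destruct (f a) eqn:Fa; [rewrite (Hfg a Fa); cbn; lia|destruct (g a); cbn; lia]. }
  induction l as [|a l IH]; [destruct Hp|]. cbn.
  destruct Hp as [<-|Hp].
  - rewrite Fp, Gp. cbn. specialize (Hle l). lia.
  - specialize (IH Hp). destruct (f a) eqn:Fa.
    + rewrite (Hfg a Fa). cbn. lia.
    + destruct (g a); cbn; lia.
Qed.

(** The order of the reals is not well-founded, but [f] takes finitely many values on [l]: the
    induction runs on the number of entries with a smaller value. *)
Lemma list_measure_ind (A : Type) (l : list A) (f : A -> R) (Q : A -> Prop) :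
  (forall x, In x l -> (forall y, In y l -> f y < f x -> Q y) -> Q x) ->
  forall x, In x l -> Q x.
Proof.
  intros Hstep.
  set (below x := filter (fun y => if Rlt_dec (f y) (f x) then true else false) l).
  assert (H : forall m x, In x l -> (length (below x) < m)%nat -> Q x).
  { induction m as [|m IH]; intros x Hx Hm; [lia|].
    apply Hstep; [exact Hx|]. intros y Hy Hlt. apply IH; [exact Hy|].
    enough (length (below y) < length (below x))%nat by lia.
    apply filter_length_lt with (p := y); [|exact Hy| |].
    - intros z. destruct (Rlt_dec (f z) (f y)); [|discriminate].
      destruct (Rlt_dec (f z) (f x)); [reflexivity|lra].
    - destruct (Rlt_dec (f y) (f y)); [lra|reflexivity].
    - destruct (Rlt_dec (f y) (f x)); [reflexivity|lra]. }
  intros x Hx. apply (H (Datatypes.S (length (below x)))); [exact Hx|lia].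
Qed.

(** * Visibility inside a triangle *)

Definition noncollinear (P : list pt) : Prop :=
  forall p q r, In p P -> In q P -> In r P -> p <> q -> p <> r -> q <> r ->
    orient p q r <> 0.

(** The share of general position that the visibility lemmas need. It is kept separate because they
    are also applied to triangles with a corner outside [P], where [noncollinear] does not apply
    directly. *)
Definition off_sides (P : list pt) (u v w : pt) : Prop :=
  forall d, In d P -> d <> u -> 0 < orient w v d -> orient v u d <> 0 /\ orient u w d <> 0.

Lemma off_sides_vertices (P : list pt) (u v w : pt) :
  noncollinear P -> In u P -> In v P -> In w P -> 0 < orient v u w -> off_sides P u v w.
Proof.
  intros HP Hu Hv Hw HD d Hd Hdu Hg.
  assert (v <> u) by (intros ->; rewrite orient_cycle, orient_diag_r in HD; lra).
  assert (u <> w) by (intros ->; rewrite orient_diag_r in HD; lra).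
  assert (v <> d) by (intros ->; rewrite orient_diag_r in Hg; lra).
  assert (w <> d) by (intros ->; rewrite orient_diag_l in Hg; lra).
  split; apply HP; auto.
Qed.

(** A constraint crossing [up] has an endpoint farther from the line [vw] than [p]. It cannot cross
    [uv] or [uw], so this endpoint lies in the triangle, against the maximality of [p]. *)
Lemma farthest_uncrossed (P : list pt) (S : list (pt * pt)) (u v w p : pt) :
  noncollinear P -> valid_constraints P S -> In u P ->
  0 < orient v u w -> uncrossed S u v -> uncrossed S u w -> off_sides P u v w ->
  in_triangle u v w p ->
  (forall q, In q P -> in_triangle u v w q -> orient w v q <= orient w v p) ->
  uncrossed S u p.
Proof.
  intros HP [HS _] Hu HD Nv Nw Off [P1 [P2 P3]] Hmax [c d] Hcd Hcross.
  destruct (HS _ Hcd) as [Hc [Hd Hne]]. specialize (Nv _ Hcd). specialize (Nw _ Hcd).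
  cbn [fst snd] in *.
  assert (Key : forall c d s t, In c P -> In d P -> c <> d ->
    ~ proper_cross u v c d -> ~ proper_cross u w c d -> proper_cross u p c d ->
    0 < s < 1 -> 0 < t < 1 -> interp s u p = interp t c d ->
    orient w v p < orient w v d -> False).
  { clear c d Hcd Hcross Hc Hd Hne Nv Nw.
    intros c d s t Hc Hd Hne Nv Nw [_ Hcross] Hs Ht E Hlt. fold (orient c d u) in Hcross.
    assert (Hou : orient c d u <> 0) by (intros Z; rewrite Z in Hcross; lra).
    assert (Hdu : d <> u) by (intros ->; apply Hou, orient_diag_r).
    destruct (Off d Hd Hdu ltac:(lra)) as [O1 O2].
    assert (T : in_triangle u v w d).
    { apply (endpoint_in_triangle u v w c d t); auto; rewrite <- ?E, ?orient_interp.
      - rewrite orient_diag_r; nra.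
      - rewrite orient_diag_l; nra.
      - rewrite orient_cycle. rewrite orient_cycle. nra.
      - lra. }
    specialize (Hmax d Hd T). lra. }
  destruct (proper_cross_point _ _ _ _ Hcross) as [s [t [Hs [Ht E]]]].
  (* The crossing point lies strictly between [p] and [u], hence farther from [vw] than [p]; so does
     one of [c], [d]. *)
  assert (L : orient w v p < (1 - t) * orient w v c + t * orient w v d).
  { rewrite <- orient_interp, <- E, orient_interp.
    assert (X := orient_sum u v w p). rewrite (orient_cycle u w v), (orient_cycle v u w). nra. }
  destruct (Rlt_le_dec (orient w v p) (orient w v d)) as [H|H].
  - exact (Key c d s t Hc Hd Hne Nv Nw Hcross Hs Ht E H).
  - apply (Key d c s (1 - t)); auto.
    + intro X; apply Nv, proper_cross_swap_r, X.
    + intro X; apply Nw, proper_cross_swap_r, X.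
    + apply proper_cross_swap_r, Hcross.
    + lra.
    + rewrite E. clear. coords. f_equal; ring.
    + nra.
Qed.

(** A constraint crossing [vw] has one endpoint on the side of [u]. That endpoint is not [u], since
    no constraint at [u] splits the angle, so the constraint has to end inside the triangle. *)
Lemma crossed_side_inner_vertex (P : list pt) (S : list (pt * pt)) (u v w : pt) :
  noncollinear P -> valid_constraints P S -> In u P ->
  0 < orient v u w -> uncrossed S u v -> uncrossed S u w -> off_sides P u v w ->
  (forall c, is_constraint S u c -> 0 < orient v u c -> 0 < orient u w c -> False) ->
  ~ uncrossed S v w ->
  exists p, In p P /\ in_triangle u v w p.
Proof.
  intros HP [HS _] Hu HD Nv Nw Off Sep Hcr.
  apply NNPP; intros Hno; apply Hcr; intros [c d] Hcd Hcross.
  destruct (HS _ Hcd) as [Hc [Hd Hne]]. specialize (Nv _ Hcd). specialize (Nw _ Hcd).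
  cbn [fst snd] in *.
  assert (Key : forall c d s t, is_constraint S d c -> In c P -> In d P -> c <> d ->
    ~ proper_cross u v c d -> ~ proper_cross u w c d -> proper_cross v w c d ->
    0 < s < 1 -> 0 < t < 1 -> interp s v w = interp t c d ->
    0 < orient w v d -> False).
  { clear c d Hcd Hcross Hc Hd Hne Nv Nw.
    intros c d s t Hcd Hc Hd Hne Nv Nw [Hc1 Hc2] Hs Ht E Hlt.
    fold (orient v w c) (orient v w d) (orient c d v) (orient c d w) in Hc1, Hc2.
    rewrite !(orient_swap w v) in Hc1.
    assert (Hgc : orient w v c < 0) by nra.
    assert (Hcu : c <> u) by (intros ->; rewrite orient_cycle, orient_cycle in Hgc; lra).
    assert (Hdu : d <> u).
    { intros ->. assert (X := orient_sum u v w c).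
      assert (orient u w c = orient c u w) by apply orient_cycle.
      assert (orient v u c = - orient c u v) by (rewrite <- orient_cycle; apply orient_swap).
      apply (Sep c Hcd); nra. }
    assert (Hou : orient c d u <> 0) by (apply HP; auto).
    destruct (Off d Hd Hdu Hlt) as [O1 O2].
    apply Hno; exists d; split; [exact Hd|].
    apply (endpoint_in_triangle u v w c d t); auto; rewrite <- ?E, ?orient_interp.
    - rewrite orient_diag_l; nra.
    - rewrite orient_diag_r, orient_cycle; nra.
    - rewrite orient_diag_r, orient_diag_l; nra. }
  destruct (proper_cross_point _ _ _ _ Hcross) as [s [t [Hs [Ht E]]]].
  destruct (Rlt_le_dec 0 (orient w v d)) as [H|H].
  - apply (Key c d s t); auto. right; exact Hcd.
  - apply (Key d c s (1 - t)); auto.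
    + left; exact Hcd.
    + intro X; apply Nv, proper_cross_swap_r, X.
    + intro X; apply Nw, proper_cross_swap_r, X.
    + apply proper_cross_swap_r, Hcross.
    + lra.
    + rewrite E. clear. coords. f_equal; ring.
    + destruct Hcross as [Hc1 _]. fold (orient v w c) (orient v w d) in Hc1.
      rewrite !(orient_swap w v) in Hc1. nra.
Qed.

Definition in_triangleb (u v w q : pt) : bool :=
  if Rlt_dec 0 (orient v u q) then
    if Rlt_dec 0 (orient u w q) then
      if Rlt_dec 0 (orient w v q) then true else false
    else false
  else false.

Lemma in_triangleb_spec (u v w q : pt) : in_triangleb u v w q = true <-> in_triangle u v w q.
Proof.
  unfold in_triangleb, in_triangle.
  destruct (Rlt_dec 0 (orient v u q)), (Rlt_dec 0 (orient u w q)), (Rlt_dec 0 (orient w v q));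
    split; try discriminate; tauto.
Qed.

Lemma angle_left (u v w p c : pt) :
  in_triangle u v w p -> 0 < orient v u w ->
  0 < orient v u c -> 0 < orient u p c -> 0 < orient u w c.
Proof.
  intros [P1 [P2 P3]] HD H1 H2.
  assert (X := orient_barycentric u v p u w c).
  rewrite orient_diag_l, (orient_cycle v u w) in X. nra.
Qed.

Lemma angle_right (u v w p c : pt) :
  in_triangle u v w p -> 0 < orient v u w ->
  0 < orient p u c -> 0 < orient u w c -> 0 < orient v u c.
Proof.
  intros [P1 [P2 P3]] HD H1 H2.
  assert (X := orient_barycentric u p w v u c).
  rewrite orient_diag_r, <- (orient_cycle p u w) in X. nra.
Qed.

Lemma in_triangle_left (u v w p q : pt) :
  in_triangle u v w p -> 0 < orient v u w -> in_triangle u v p q -> in_triangle u v w q.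
Proof.
  intros HP HD [Q1 [Q2 Q3]]. split; [exact Q1|].
  split; [eapply angle_left; eauto|]. destruct HP as [P1 [P2 P3]].
  assert (X := orient_barycentric u v p w v q).
  rewrite orient_diag_r, (orient_cycle u w v), (orient_cycle v u w) in X. nra.
Qed.

Lemma in_triangle_right (u v w p q : pt) :
  in_triangle u v w p -> 0 < orient v u w -> in_triangle u p w q -> in_triangle u v w q.
Proof.
  intros HP HD [Q1 [Q2 Q3]].
  split; [eapply angle_right; eauto|]. split; [exact Q2|]. destruct HP as [P1 [P2 P3]].
  assert (X := orient_barycentric u p w w v q).
  rewrite orient_diag_l, (orient_cycle u w v), (orient_cycle v u w), <- (orient_cycle p u w) in X.
  nra.
Qed.

Lemma barycentric_point (v x w p : pt) :
  orient v x w <> 0 ->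
  p = vadd (vscale (orient x w p / orient v x w) v)
        (vadd (vscale (orient w v p / orient v x w) x)
              (vscale (orient v x p / orient v x w) w)).
Proof. intros H. coords. f_equal; field; exact H. Qed.

(** * Convex chains *)

Record seminorm (N : pt -> R) : Prop := {
  seminorm_add : forall e f, N (vadd e f) <= N e + N f;
  seminorm_scale : forall a e, 0 <= a -> N (vscale a e) = a * N e;
  seminorm_ge0 : forall e, 0 <= N e }.

(** [L] is only an upper bound for the [N]-length. Chains are binary trees of concatenations,
    matching the recursion of [hull_chain]. *)
Inductive vis_chain (P : list pt) (S : list (pt * pt)) (N : pt -> R) : pt -> pt -> R -> Prop :=
| vis_chain_edge v w L :
    In v P -> In w P -> v <> w -> uncrossed S v w -> N (vsub w v) <= L -> vis_chain P S N v w L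
| vis_chain_cat v p w L1 L2 L :
    vis_chain P S N v p L1 -> vis_chain P S N p w L2 -> L1 + L2 <= L -> vis_chain P S N v w L.

(** If [vw] is crossed, take the inner vertex [p] farthest from [vw]; it is visible from [u]. The
    line through [p] parallel to [vw] meets [vx] and [xw] in the apexes for the recursive chains
    from [v] to [p] and from [p] to [w], and cutting off the corner at [x] does not lengthen the
    bound. *)
Lemma hull_chain (P : list pt) (S : list (pt * pt)) (N : pt -> R) (u v w x : pt) :
  noncollinear P -> valid_constraints P S -> seminorm N -> In u P -> In v P -> In w P ->
  0 < orient v u w -> uncrossed S u v -> uncrossed S u w ->
  (forall c, is_constraint S u c -> 0 < orient v u c -> 0 < orient u w c -> False) ->
  (forall q, In q P -> in_triangle u v w q -> 0 <= orient v x q /\ 0 <= orient x w q) ->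
  vis_chain P S N v w (N (vsub x v) + N (vsub w x)).
Proof.
  intros HP HS HN Hu.
  (* Induction on the number of vertices inside the triangle: both smaller triangles lose at least
     [p]. *)
  enough (H : forall m v w x, (length (filter (in_triangleb u v w) P) < m)%nat ->
    In v P -> In w P -> 0 < orient v u w -> uncrossed S u v -> uncrossed S u w ->
    (forall c, is_constraint S u c -> 0 < orient v u c -> 0 < orient u w c -> False) ->
    (forall q, In q P -> in_triangle u v w q -> 0 <= orient v x q /\ 0 <= orient x w q) ->
    vis_chain P S N v w (N (vsub x v) + N (vsub w x))).
  { intros. eapply H; eauto. }
  clear v w x. intros m; induction m as [|m IH]; intros v w x Hm Hv Hw HD Nv Nw Sep Reg; [lia|].
  assert (Hxw : N (vsub w v) <= N (vsub x v) + N (vsub w x)).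
  { replace (vsub w v) with (vadd (vsub x v) (vsub w x)) by (clear; coords; f_equal; ring).
    apply seminorm_add, HN. }
  destruct (classic (uncrossed S v w)) as [Hvw|Hvw].
  { apply vis_chain_edge; auto. intros ->.
    rewrite orient_diag_l in HD. lra. }
  assert (Off := off_sides_vertices P u v w HP Hu Hv Hw HD).
  assert (Ex := crossed_side_inner_vertex P S u v w HP HS Hu HD Nv Nw Off Sep Hvw).
  destruct (list_argmin _ P (in_triangle u v w) (fun q => - orient w v q) Ex)
    as [p [Hp [Tp Hmin]]].
  assert (Hmax : forall q, In q P -> in_triangle u v w q -> orient w v q <= orient w v p).
  { intros q Hq Tq. specialize (Hmin q Hq Tq). cbn in Hmin. lra. }
  assert (Np := farthest_uncrossed P S u v w p HP HS Hu HD Nv Nw Off Tp Hmax).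
  destruct (Reg p Hp Tp) as [RA RB].
  assert (Tp' := Tp). destruct Tp' as [P1 [P2 P3]].
  assert (Es := orient_sum x v w p).
  assert (Ep := barycentric_point v x w p).
  set (D := orient v x w) in *.
  assert (HDp : 0 < D) by lra. specialize (Ep ltac:(lra)).
  (* [al], [be], [ga] are the barycentric coordinates of [p] in [v], [x], [w], so the parallel to
     [vw] through [p] meets [vx] at [interp be v x] and [wx] at [interp be w x]. *)
  set (al := orient x w p / D) in *. set (be := orient w v p / D) in *.
  set (ga := orient v x p / D) in *.
  assert (Hsum : al = 1 - be - ga).
  { assert (D <> 0) by lra. unfold al, be, ga. apply (Rmult_eq_reg_l D); [|lra].
    field_simplify; lra. }
  assert (Hal : 0 <= al) by (apply Rle_mult_inv_pos; lra).
  assert (Hbe : 0 <= be) by (apply Rle_mult_inv_pos; lra).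
  assert (Hga : 0 <= ga) by (apply Rle_mult_inv_pos; lra).
  clearbody al be ga.
  assert (X1 : vsub p (interp be v x) = vscale ga (vsub w v)).
  { rewrite Ep, Hsum. clear. coords. f_equal; ring. }
  assert (X2 : vsub (interp be w x) p = vscale al (vsub w v)).
  { replace ga with (1 - be - al) in Ep by lra. rewrite Ep. clear. coords. f_equal; ring. }
  assert (Lt1 : (length (filter (in_triangleb u v p) P)
    < length (filter (in_triangleb u v w) P))%nat).
  { apply filter_length_lt with (p := p); [| exact Hp | | now apply in_triangleb_spec].
    - intros q. rewrite !in_triangleb_spec. now apply in_triangle_left.
    - apply Bool.not_true_is_false. rewrite in_triangleb_spec. intros [_ [_ Z]].
      rewrite orient_diag_l in Z. lra. }
  assert (Lt2 : (length (filter (in_triangleb u p w) P)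
    < length (filter (in_triangleb u v w) P))%nat).
  { apply filter_length_lt with (p := p); [| exact Hp | | now apply in_triangleb_spec].
    - intros q. rewrite !in_triangleb_spec. now apply in_triangle_right.
    - apply Bool.not_true_is_false. rewrite in_triangleb_spec. intros [Z _].
      rewrite orient_diag_l in Z. lra. }
  apply vis_chain_cat with (p := p)
    (L1 := N (vsub (interp be v x) v) + N (vsub p (interp be v x)))
    (L2 := N (vsub (interp be w x) p) + N (vsub w (interp be w x))).
  - apply IH; auto; [lia| |].
    + intros c Hc C1 C2. apply (Sep c Hc C1). eapply angle_left; eauto.
    (* The new apex is on [vx], which gives the first bound; the second says that no inner vertex is
       farther from [vw] than [p]. *)
    + intros q Hq Tq. apply (in_triangle_left u v w p q Tp HD) in Tq.
      destruct (Reg q Hq Tq) as [A B]. specialize (Hmax q Hq Tq). split.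
      * replace (orient v (interp be v x) q) with (be * orient v x q) by (clear; coords; ring).
        nra.
      * unfold orient at 1. rewrite X1.
        replace (cross _ _) with (ga * cross (vsub w v) (vsub q p) +
          ga * cross (vsub w v) (vsub p (interp be v x))) by (clear; coords; ring).
        rewrite X1.
        replace (ga * _ + _) with (ga * (orient w v p - orient w v q)) by (clear; coords; ring).
        nra.
  - apply IH; auto; [lia| rewrite <- (orient_cycle p u w); exact P2 | |].
    + intros c Hc C1 C2. apply (Sep c Hc); [eapply angle_right; eauto | exact C2].
    + intros q Hq Tq. apply (in_triangle_right u v w p q Tp HD) in Tq.
      destruct (Reg q Hq Tq) as [A B]. specialize (Hmax q Hq Tq). split.
      * unfold orient at 1. rewrite X2.
        replace (cross _ _) with (al * (orient w v p - orient w v q)) by (clear; coords; ring).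
        nra.
      * replace (orient (interp be w x) w q) with (be * orient x w q) by (clear; coords; ring).
        nra.
  - rewrite X1, X2.
    replace (vsub (interp be v x) v) with (vscale be (vsub x v)) by (clear; coords; f_equal; ring).
    replace (vsub w (interp be w x)) with (vscale be (vsub w x)) by (clear; coords; f_equal; ring).
    (* The new total is a convex combination, with weights [be] and [1 - be], of the old bound and
       [N (vsub w v)]. *)
    rewrite !(seminorm_scale N HN) by assumption.
    assert (be <= 1) by lra. subst al. nra.
Qed.

Lemma vis_chain_sym (P : list pt) (S : list (pt * pt)) (N : pt -> R) (v w : pt) (L : R) :
  (forall a b, N (vsub a b) = N (vsub b a)) ->
  vis_chain P S N v w L -> vis_chain P S N w v L.
Proof.
  intros HN H. induction H as [v w L Hv Hw Hne Hun HL | v p w L1 L2 L _ IH1 _ IH2 HL].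
  - apply vis_chain_edge; auto; [|rewrite HN; exact HL].
    intros c Hc X. apply (Hun c Hc), proper_cross_swap_l, X.
  - apply vis_chain_cat with (p := p) (L1 := L2) (L2 := L1); auto. lra.
Qed.

Lemma vis_chain_ge0 (P : list pt) (S : list (pt * pt)) (N : pt -> R) (v w : pt) (L : R) :
  seminorm N -> vis_chain P S N v w L -> 0 <= L.
Proof.
  intros HN H. induction H as [v w L _ _ _ _ HL|]; [|lra].
  assert (X := seminorm_ge0 N HN (vsub w v)). lra.
Qed.

(** * The 1-norm in the frame of a cone *)

Definition l1 (b e : pt) : R := Rabs (dot e b) + Rabs (cross b e).

Lemma l1_seminorm (b : pt) : seminorm (l1 b).
Proof.
  split; unfold l1.
  - intros e f.
    replace (dot (vadd e f) b) with (dot e b + dot f b) by (coords; ring).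
    replace (cross b (vadd e f)) with (cross b e + cross b f) by (coords; ring).
    assert (A := Rabs_triang (dot e b) (dot f b)).
    assert (B := Rabs_triang (cross b e) (cross b f)). lra.
  - intros a e Ha.
    replace (dot (vscale a e) b) with (a * dot e b) by (coords; ring).
    replace (cross b (vscale a e)) with (a * cross b e) by (coords; ring).
    rewrite !Rabs_mult, (Rabs_pos_eq a) by exact Ha. ring.
  - intros e. assert (A := Rabs_pos (dot e b)). assert (B := Rabs_pos (cross b e)). lra.
Qed.

Lemma l1_sym (b v w : pt) : l1 b (vsub v w) = l1 b (vsub w v).
Proof.
  unfold l1.
  replace (dot (vsub v w) b) with (- dot (vsub w v) b) by (coords; ring).
  replace (cross b (vsub v w)) with (- cross b (vsub w v)) by (coords; ring).
  now rewrite !Rabs_Ropp.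
Qed.

(** * The Euclidean norm and polar coordinates *)

Lemma dot_self_ge0 (e : pt) : 0 <= dot e e.
Proof. coords; nra. Qed.

Lemma vnorm_ge0 (e : pt) : 0 <= vnorm e.
Proof. apply sqrt_pos. Qed.

Lemma vnorm_sqr (e : pt) : vnorm e * vnorm e = dot e e.
Proof. apply sqrt_sqrt, dot_self_ge0. Qed.

Lemma vnorm_pos (a b : pt) : a <> b -> 0 < vnorm (vsub b a).
Proof.
  intros H. apply sqrt_lt_R0.
  destruct (Rle_lt_or_eq_dec _ _ (dot_self_ge0 (vsub b a))) as [L|E]; [exact L|].
  exfalso; apply H. destruct a as [ax ay], b as [bx b2].
  unfold dot, vsub in E; cbn [fst snd] in E.
  destruct (Rplus_sqr_eq_0 _ _ (eq_sym E)). f_equal; lra.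
Qed.

Lemma vnorm_scale (a : R) (e : pt) : 0 <= a -> vnorm (vscale a e) = a * vnorm e.
Proof.
  intros Ha. unfold vnorm. replace (dot (vscale a e) (vscale a e)) with ((a * a) * dot e e)
    by (coords; ring).
  rewrite sqrt_mult by (nra || apply dot_self_ge0). rewrite sqrt_square by exact Ha. reflexivity.
Qed.

Lemma dot_le_vnorm (e f : pt) : dot e f <= vnorm e * vnorm f.
Proof.
  apply Rsqr_incr_0_var; [|apply Rmult_le_pos; apply vnorm_ge0].
  unfold Rsqr. replace (vnorm e * vnorm f * (vnorm e * vnorm f))
    with ((vnorm e * vnorm e) * (vnorm f * vnorm f)) by ring.
  rewrite !vnorm_sqr.
  enough (0 <= cross e f * cross e f) by (coords; nra). nra.
Qed.

Lemma vnorm_add (e f : pt) : vnorm (vadd e f) <= vnorm e + vnorm f.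
Proof.
  assert (He := vnorm_ge0 e). assert (Hf := vnorm_ge0 f).
  apply Rsqr_incr_0_var; [|lra]. unfold Rsqr.
  rewrite vnorm_sqr. assert (H := dot_le_vnorm e f).
  assert (Se := vnorm_sqr e). assert (Sf := vnorm_sqr f).
  replace (dot (vadd e f) (vadd e f)) with (dot e e + dot f f + 2 * dot e f) by (coords; ring).
  nra.
Qed.

Lemma frame_pythagoras (b e : pt) :
  dot b b = 1 -> dot e b * dot e b + cross b e * cross b e = vnorm e * vnorm e.
Proof.
  intros Hb. rewrite vnorm_sqr. transitivity (dot e e * dot b b); [coords; ring|].
  rewrite Hb; ring.
Qed.

Lemma cw_dir_unit (t : R) : dot (cw_dir t) (cw_dir t) = 1.
Proof. unfold dot, cw_dir; cbn [fst snd]. assert (H := sin2_cos2 t). unfold Rsqr in H. lra. Qed.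

Lemma dot_cw_dir (r s t : R) : dot (vscale r (cw_dir t)) (cw_dir s) = r * cos (t - s).
Proof. unfold dot, vscale, cw_dir; cbn [fst snd]. rewrite cos_minus. ring. Qed.

Lemma cross_cw_dir (r s t : R) : cross (cw_dir s) (vscale r (cw_dir t)) = - (r * sin (t - s)).
Proof. unfold cross, vscale, cw_dir; cbn [fst snd]. rewrite sin_minus. ring. Qed.

Lemma polar_form (e : pt) :
  0 < vnorm e -> exists t, 0 <= t <= 2 * PI /\ e = vscale (vnorm e) (cw_dir t).
Proof.
  intros Hr. assert (Hs := vnorm_sqr e). set (r := vnorm e) in *.
  destruct e as [x y]. unfold dot in Hs; cbn [fst snd] in Hs.
  assert (Hy : -1 <= y / r <= 1).
  { split; apply (Rmult_le_reg_r r); try exact Hr; unfold Rdiv;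
      rewrite Rmult_assoc, Rinv_l; nra. }
  assert (Hb := acos_bound (y / r)).
  assert (Hc := cos_acos (y / r) Hy). assert (Hsn := sin_acos (y / r) Hy).
  assert (Hx : sqrt (1 - (y / r)²) = Rabs x / r).
  { replace (1 - (y / r)²) with ((x / r)²).
    - rewrite sqrt_Rsqr_abs. unfold Rdiv. rewrite Rabs_mult, Rabs_inv, (Rabs_pos_eq r); lra.
    - unfold Rsqr. apply (Rmult_eq_reg_l (r * r)); [|nra]. field_simplify; lra. }
  rewrite Hx in Hsn.
  destruct (Rle_lt_dec 0 x) as [H|H].
  - exists (acos (y / r)). split; [lra|]. unfold vscale, cw_dir; cbn [fst snd].
    rewrite Hc, Hsn, Rabs_pos_eq by exact H. f_equal; field; lra.
  - exists (2 * PI - acos (y / r)). split; [lra|]. unfold vscale, cw_dir; cbn [fst snd].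
    rewrite sin_minus, cos_minus, sin_2PI, cos_2PI, Hc, Hsn, Rabs_left by exact H.
    f_equal; field; lra.
Qed.

(** For [s] an angle in units of the cone angle, integers are bisectors and half-integers are
    boundary rays. The value [j = n] is a full turn, that is, cone 0 again. *)
Lemma nearest_nat (n : nat) (s : R) :
  0 <= s <= INR n ->
  (exists j, (j < n)%nat /\ s = INR j + 1 / 2) \/
  (exists j, (j <= n)%nat /\ Rabs (s - INR j) < 1 / 2).
Proof.
  induction n as [|n IH]; intros Hs.
  - right. exists 0%nat. split; [lia|]. cbn in *. apply Rabs_def1; lra.
  - rewrite S_INR in Hs. destruct (Rle_lt_dec s (INR n)) as [H|H].
    + destruct IH as [[j [Hj E]]|[j [Hj E]]]; [lra| |].
      * left. exists j. split; [lia|exact E].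
      * right. exists j. split; [lia|exact E].
    + destruct (Rtotal_order s (INR n + 1 / 2)) as [L|[E|L]].
      * right. exists n. split; [lia|]. apply Rabs_def1; lra.
      * left. exists n. split; [lia|exact E].
      * right. exists (Datatypes.S n). split; [lia|]. rewrite S_INR. apply Rabs_def1; lra.
Qed.

(** * The cone angle and the nearest bisector *)

Lemma cone_angle_half_turn (k : nat) : 2 * INR (k + 1) * cone_angle (4 * k + 4) = PI.
Proof.
  unfold cone_angle. replace (4 * k + 4)%nat with (4 * (k + 1))%nat by lia.
  rewrite mult_INR. replace (INR 4) with 4 by (cbn; lra). field.
  rewrite plus_INR. cbn. assert (H := pos_INR k). lra.
Qed.

Lemma cone_angle_pos (k : nat) : 0 < cone_angle (4 * k + 4).
Proof.
  assert (H := cone_angle_half_turn k). assert (Hp := PI_RGT_0).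
  assert (0 < INR (k + 1)) by (apply lt_0_INR; lia). nra.
Qed.

Lemma cone_angle_full_turn (k : nat) : INR (4 * k + 4) * cone_angle (4 * k + 4) = 2 * PI.
Proof.
  unfold cone_angle. field. apply not_0_INR. lia.
Qed.

(** The function [|sin|] has period [PI], which is [k + 1] shifts by twice the cone angle, so [m]
    may be taken at most [k]. For [1 <= m <= k] the shifted argument lies between [th] and
    [PI - th], where the sine is at least [sin th]. *)
Lemma abs_sin_shift (k m : nat) (y : R) :
  - cone_angle (4 * k + 4) <= y <= cone_angle (4 * k + 4) ->
  Rabs (sin y) <= Rabs (sin (y + 2 * INR m * cone_angle (4 * k + 4))).
Proof.
  intros Hyb. assert (Ht := cone_angle_pos k). assert (HT := cone_angle_half_turn k).
  set (th := cone_angle (4 * k + 4)) in *.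
  induction m as [m IH] using (well_founded_induction Wf_nat.lt_wf).
  destruct (Nat.eq_dec m 0) as [->|Hm].
  { cbn. replace (y + 2 * 0 * th) with y by ring. lra. }
  destruct (Nat.le_gt_cases (k + 1) m) as [Hk|Hk].
  - specialize (IH (m - (k + 1))%nat ltac:(lia)). rewrite minus_INR in IH by lia.
    replace (y + 2 * INR m * th) with (y + 2 * (INR m - INR (k + 1)) * th + PI)
      by (rewrite <- HT; ring).
    rewrite neg_sin, Rabs_Ropp. exact IH.
  - assert (M1 : 1 <= INR m) by (change 1 with (INR 1); apply le_INR; lia).
    assert (M2 : INR m + 1 <= INR (k + 1)) by (rewrite <- S_INR; apply le_INR; lia).
    assert (B1 : th <= y + 2 * INR m * th) by nra.
    assert (B2 : y + 2 * INR m * th <= PI - th) by nra.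
    assert (Hth : th <= PI / 2) by lra.
    set (z := y + 2 * INR m * th) in *.
    assert (Hp := PI_RGT_0).
    assert (Sy : Rabs (sin y) <= sin th).
    { apply Rabs_le. split; [rewrite <- sin_neg|]; apply sin_incr_1; lra. }
    assert (Sz : sin th <= sin z).
    { destruct (Rle_lt_dec z (PI / 2)) as [H|H].
      - apply sin_incr_1; lra.
      - rewrite <- (sin_PI_x z). apply sin_incr_1; lra. }
    assert (X := Rle_abs (sin z)). lra.
Qed.

(** The square of [|cos x| + |sin x|] is [1 + |sin (2 x)|]. *)
Lemma abs_cos_sin_le (x y : R) :
  Rabs (sin (2 * x)) <= Rabs (sin (2 * y)) ->
  Rabs (cos x) + Rabs (sin x) <= Rabs (cos y) + Rabs (sin y).
Proof.
  rewrite !sin_2a, !Rabs_mult, (Rabs_pos_eq 2) by lra. intros H.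
  assert (Sq : forall z, Rabs (cos z) * Rabs (cos z) + Rabs (sin z) * Rabs (sin z) = 1).
  { intros z. assert (X := sin2_cos2 z). rewrite Rsqr_abs, (Rsqr_abs (cos z)) in X.
    unfold Rsqr in X. lra. }
  assert (Sx := Sq x). assert (Sy := Sq y).
  assert (Py1 := Rabs_pos (cos y)). assert (Py2 := Rabs_pos (sin y)).
  apply Rsqr_incr_0_var; [unfold Rsqr|]; nra.
Qed.

(** After doubling the angles, passing from frame [j] to frame [i] is a shift by a multiple of twice
    the cone angle, as in [abs_sin_shift]; a shift in the other direction is reflected by the
    oddness of the sine. *)
Lemma nearest_bisector_l1 (k i j : nat) (r t : R) :
  0 <= r ->
  - (cone_angle (4 * k + 4) / 2) <= t - INR j * cone_angle (4 * k + 4)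
    <= cone_angle (4 * k + 4) / 2 ->
  l1 (bisector (4 * k + 4) j) (vscale r (cw_dir t)) <=
  l1 (bisector (4 * k + 4) i) (vscale r (cw_dir t)).
Proof.
  intros Hr Ht. unfold l1, bisector.
  rewrite !dot_cw_dir, !cross_cw_dir, !Rabs_Ropp, !Rabs_mult, (Rabs_pos_eq r) by exact Hr.
  rewrite <- !Rmult_plus_distr_l. apply Rmult_le_compat_l; [exact Hr|].
  apply abs_cos_sin_le. set (th := cone_angle (4 * k + 4)) in *.
  destruct (Nat.le_ge_cases i j) as [H|H].
  - replace (2 * (t - INR i * th)) with (2 * (t - INR j * th) + 2 * INR (j - i) * th)
      by (rewrite minus_INR by exact H; ring).
    apply abs_sin_shift. fold th. lra.
  - replace (2 * (t - INR i * th)) with (- (- (2 * (t - INR j * th)) + 2 * INR (i - j) * th))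
      by (rewrite minus_INR by exact H; ring).
    rewrite sin_neg, Rabs_Ropp.
    replace (Rabs (sin (2 * (t - INR j * th)))) with (Rabs (sin (- (2 * (t - INR j * th)))))
      by (rewrite sin_neg; apply Rabs_Ropp).
    apply abs_sin_shift. fold th. lra.
Qed.

Lemma bisector_wrap (k : nat) : bisector (4 * k + 4) (4 * k + 4) = bisector (4 * k + 4) 0.
Proof.
  unfold bisector. rewrite cone_angle_full_turn. unfold cw_dir. cbn [INR].
  now rewrite Rmult_0_l, sin_2PI, cos_2PI, sin_0, cos_0.
Qed.

Lemma cone_exists (k : nat) (P : list pt) (a b : pt) :
  general_position (4 * k + 4) P -> In a P -> In b P -> a <> b ->
  exists j, (j < 4 * k + 4)%nat /\ in_cone (4 * k + 4) a j b /\
    forall i, l1 (bisector (4 * k + 4) j) (vsub b a) <= l1 (bisector (4 * k + 4) i) (vsub b a).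
Proof.
  intros [GP _] Ha Hb Hab. destruct (GP a b Ha Hb Hab) as [Gray _].
  assert (Hr := vnorm_pos a b Hab). unfold in_cone.
  destruct (polar_form _ Hr) as [t [Ht E]]. set (r := vnorm (vsub b a)) in *.
  rewrite E in Gray |- *. clearbody r.
  assert (Hth := cone_angle_pos k). assert (HT := cone_angle_half_turn k).
  assert (HF := cone_angle_full_turn k).
  set (n := (4 * k + 4)%nat) in *. set (th := cone_angle n) in *.
  assert (Hs : 0 <= t / th <= INR n).
  { split; [apply Rle_mult_inv_pos; lra|].
    apply (Rmult_le_reg_r th); [exact Hth|]. unfold Rdiv.
    rewrite Rmult_assoc, Rinv_l; lra. }
  assert (Et : t = t / th * th) by (field; lra).
  assert (Hkp : th <= PI / 2).
  { assert (1 <= INR (k + 1)) by (change 1 with (INR 1); apply le_INR; lia). nra. }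
  destruct (nearest_nat n (t / th) Hs) as [[j [Hj Ej]]|[j [Hj Ej]]].
  (* A half-integer quotient would put [b] on a line parallel to a boundary ray through [a]. *)
  - exfalso. apply (Gray j Hj). unfold ray_dir. rewrite cross_cw_dir.
    rewrite Ej in Et. fold th. replace (t - (INR j + 1 / 2) * th) with 0 by lra.
    rewrite sin_0. ring.
  - apply Rabs_def2 in Ej.
    assert (Hd : - (th / 2) < t - INR j * th < th / 2) by (rewrite Et; nra).
    assert (Hj' : exists j', (j' < n)%nat /\ bisector n j' = bisector n j).
    { destruct (Nat.eq_dec j n) as [->|Hn].
      - exists 0%nat. split; [unfold n; lia|]. symmetry. apply bisector_wrap.
      - exists j. split; [lia|reflexivity]. }
    destruct Hj' as [j' [Hj' Eb]]. exists j'. split; [exact Hj'|]. rewrite Eb. split.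
    + unfold bisector. fold th. rewrite dot_cw_dir.
      apply Rlt_gt, Rmult_lt_compat_l; [exact Hr|].
      assert (Hp := PI_RGT_0).
      destruct (Rle_lt_dec 0 (t - INR j * th)) as [H|H].
      * apply cos_decreasing_1; lra.
      * rewrite <- (cos_neg (t - INR j * th)). apply cos_decreasing_1; lra.
    + intros i. apply nearest_bisector_l1; [lra|]. fold n th. lra.
Qed.

(** * The chain from the selected vertex *)

Lemma uncrossed_interp (S : list (pt * pt)) (u w : pt) (t : R) :
  0 < t < 1 -> uncrossed S u w -> uncrossed S u (interp t u w).
Proof.
  intros Ht H c Hc X. apply (H c Hc). revert X. rewrite !proper_cross_orient, orient_interp.
  replace (orient u (interp t u w) (fst c)) with (t * orient u w (fst c)) by (coords; ring).
  replace (orient u (interp t u w) (snd c)) with (t * orient u w (snd c)) by (coords; ring).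
  intros [A B]. split.
  - assert (0 < t * t) by nra. nra.
  - assert (Y : 0 <= (1 - t) * (orient (fst c) (snd c) u * orient (fst c) (snd c) u)) by nra.
    nra.
Qed.

(** Among the inner vertices, if there are any, one farthest from [vw] would be visible from [u]. *)
Lemma no_visible_no_inner (P : list pt) (S : list (pt * pt)) (u v w : pt) :
  noncollinear P -> valid_constraints P S -> In u P ->
  0 < orient v u w -> uncrossed S u v -> uncrossed S u w -> off_sides P u v w ->
  (forall p, In p P -> in_triangle u v w p -> uncrossed S u p -> False) ->
  forall p, In p P -> in_triangle u v w p -> False.
Proof.
  intros HP HS Hu HD Nv Nw Off Hno p Hp Tp.
  destruct (list_argmin _ P (in_triangle u v w) (fun q => - orient w v q))
    as [q [Hq [Tq Hmin]]]; [now exists p|].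
  apply (Hno q Hq Tq), (farthest_uncrossed P S u v w q); auto.
  intros z Hz Tz. specialize (Hmin z Hz Tz). cbn in Hmin. lra.
Qed.

Lemma cross_frame (b e f : pt) :
  dot b b = 1 -> cross e f = dot e b * cross b f - cross b e * dot f b.
Proof.
  intros H. transitivity (dot b b * cross e f); [rewrite H; ring|]. coords; ring.
Qed.

(** What the choice of [v] by [u] says about the angle from [a] to [c] at [u]. The sides are
    parameters because [w] may lie on either side of [uv]. *)
Definition empty_below (P : list pt) (S : list (pt * pt)) (u b v a c : pt) : Prop :=
  (forall d, is_constraint S u d -> 0 < orient a u d -> 0 < orient u c d -> False) /\
  (forall q, In q P -> uncrossed S u q -> 0 < orient a u q -> 0 < orient u c q ->
     dot (vsub v u) b <= dot (vsub q u) b).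

(** With [x] the point of [uw] at the projection of [v], the triangle [uvx] has no inner vertex: a
    visible one would project closer than [v], and an invisible one would entail a visible one. So
    the vertices inside [uvw] satisfy the region hypothesis of [hull_chain] with apex [x]. *)
Lemma first_vertex_chain (P : list pt) (S : list (pt * pt)) (u v w b : pt) (t : R) :
  noncollinear P -> valid_constraints P S -> In u P -> In v P -> In w P ->
  dot b b = 1 -> 0 < t < 1 -> 0 < dot (vsub w u) b ->
  dot (vsub v u) b = t * dot (vsub w u) b ->
  v <> w -> uncrossed S u v -> uncrossed S u w ->
  (0 < orient v u w -> empty_below P S u b v v w) ->
  (0 < orient w u v -> empty_below P S u b v w v) ->
  vis_chain P S (l1 b) v w (l1 b (vsub (interp t u w) v) + l1 b (vsub w (interp t u w))).
Proof.
  intros HP HS Hu Hv Hw Hb Ht Hpw Hpv Hvw Nv Nw Emp1 Emp2.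
  assert (Nx := uncrossed_interp S u w t Ht Nw).
  set (x := interp t u w) in *.
  set (s := cross b (vsub v x)).
  assert (Hzero : forall e, vsub e u = vadd (vsub e x) (vscale t (vsub w u)))
    by (intros e; unfold x; clear; coords; f_equal; ring).
  assert (Hvx : dot (vsub v x) b = 0).
  { assert (E := f_equal (fun z => dot z b) (Hzero v)). cbn in E.
    replace (dot (vadd _ _) b) with (dot (vsub v x) b + t * dot (vsub w u) b) in E
      by (clear; coords; ring). lra. }
  assert (Hqx : forall q, dot (vsub q x) b = dot (vsub q u) b - dot (vsub v u) b).
  { intros q. rewrite Hpv. rewrite (Hzero q). clear. coords; ring. }
  (* As [vx] is perpendicular to [b], the side of this line is decided by the projection; by [F2],
     the sign of [s] tells on which side of [uw] the vertex [v] lies. *)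
  assert (F1 : forall q, orient x v q = s * (dot (vsub v u) b - dot (vsub q u) b)).
  { intros q. unfold orient. rewrite (cross_frame b _ _ Hb), Hvx, Hqx. fold s. ring. }
  assert (F2 : orient v u w = dot (vsub w u) b * s).
  { transitivity (cross (vsub w u) (vsub v x)).
    - unfold x; clear; coords; ring.
    - rewrite (cross_frame b _ _ Hb), Hvx. fold s. ring. }
  assert (Ux : forall q, orient u x q = t * orient u w q)
    by (intros q; unfold x; clear; coords; ring).
  assert (Xw : forall q, orient x w q = (1 - t) * orient u w q)
    by (intros q; unfold x; clear; coords; ring).
  assert (Vux : orient v u x = t * orient v u w) by (unfold x; clear; coords; ring).
  assert (Hvu : v <> u).
  { intros ->. replace (dot (vsub u u) b) with 0 in Hpv by (clear; coords; ring). nra. }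
  assert (Hwu : w <> u).
  { intros ->. replace (dot (vsub u u) b) with 0 in Hpw by (clear; coords; ring). lra. }
  assert (HD : orient v u w <> 0) by (apply HP; auto).
  destruct (Rlt_le_dec 0 (orient v u w)) as [Hpos|Hneg].
  - destruct (Emp1 Hpos) as [Sep Low]. clear Emp1 Emp2.
    assert (Hs : 0 < s) by nra.
    assert (Low' : forall q, In q P -> in_triangle u v x q -> False).
    { apply (no_visible_no_inner P S); auto; [rewrite Vux; nra| |].
      - intros d Hd Hdu Hg. rewrite Ux.
        assert (d <> v) by (intros ->; rewrite orient_diag_r in Hg; lra).
        assert (d <> w) by (intros ->; rewrite F1, Hpv in Hg;
          assert (0 < (1 - t) * dot (vsub w u) b) by nra; nra).
        split; [apply HP; auto|].
        apply Rmult_integral_contrapositive_currified; [lra|apply HP; auto].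
      - intros q Hq [Q1 [Q2 Q3]] Nq. rewrite Ux in Q2. rewrite F1 in Q3.
        assert (Q2' : 0 < orient u w q) by nra.
        specialize (Low q Hq Nq Q1 Q2'). nra. }
    apply (hull_chain P S (l1 b) u); auto; [apply l1_seminorm|].
    intros q Hq [Q1 [Q2 Q3]]. rewrite orient_swap, F1, Xw. split; [|nra].
    destruct (Rlt_le_dec (dot (vsub q u) b) (dot (vsub v u) b)) as [H|H]; [|nra].
    exfalso. apply (Low' q Hq). split; [exact Q1|]. rewrite Ux, F1. split; nra.
  - assert (Hpos : 0 < orient w u v).
    { replace (orient w u v) with (- orient v u w) by (clear; coords; ring). lra. }
    destruct (Emp2 Hpos) as [Sep Low]. clear Emp1 Emp2.
    assert (Hs : s < 0) by nra.
    assert (Low' : forall q, In q P -> in_triangle u x v q -> False).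
    { apply (no_visible_no_inner P S); auto.
      - replace (orient x u v) with (t * orient w u v) by (unfold x; clear; coords; ring). nra.
      - intros d Hd Hdu Hg. rewrite (orient_swap u x), Ux. rewrite (orient_swap x v), F1 in Hg.
        assert (d <> v) by (intros ->; lra).
        assert (d <> w) by (intros ->; rewrite Hpv in Hg;
          assert (0 < (1 - t) * dot (vsub w u) b) by nra; nra).
        split; [|apply HP; auto].
        apply Ropp_neq_0_compat, Rmult_integral_contrapositive_currified; [lra|apply HP; auto].
      - intros q Hq [Q1 [Q2 Q3]] Nq. rewrite (orient_swap u x), Ux in Q1.
        rewrite (orient_swap x v), F1 in Q3.
        assert (Q1' : 0 < orient w u q) by (rewrite (orient_swap u w); nra).
        specialize (Low q Hq Nq Q1' Q2). nra. }
    (* In the mirrored case the hull chain runs from [w] to [v] and is reversed. *)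
    apply vis_chain_sym; [apply l1_sym|]. rewrite Rplus_comm.
    rewrite (l1_sym b w x), (l1_sym b x v).
    apply (hull_chain P S (l1 b) u); auto; [apply l1_seminorm|].
    intros q Hq [Q1 [Q2 Q3]]. rewrite (orient_swap x w), Xw, F1.
    rewrite (orient_swap u w) in Q1. split; [nra|].
    destruct (Rlt_le_dec (dot (vsub q u) b) (dot (vsub v u) b)) as [H|H]; [|nra].
    exfalso. apply (Low' q Hq). split; [|split; [exact Q2|]].
    + rewrite (orient_swap u x), Ux. nra.
    + rewrite (orient_swap x v), F1. nra.
Qed.

(** The leg from [v] to [x] runs across the bisector and costs at most [t |q_w| + |q_v|], where [p]
    and [q] are the coordinates along and across it; the leg from [x] to [w] costs
    [(1 - t) (p_w + |q_w|)], and [p_v = t p_w]. *)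
Lemma detour_l1 (u v w b : pt) (t : R) :
  0 < t < 1 -> 0 < dot (vsub w u) b ->
  dot (vsub v u) b = t * dot (vsub w u) b ->
  l1 b (vsub (interp t u w) v) + l1 b (vsub w (interp t u w)) + dot (vsub v u) b
  <= l1 b (vsub w u) + Rabs (cross b (vsub v u)).
Proof.
  intros Ht Hpw Hpv. unfold l1.
  replace (dot (vsub (interp t u w) v) b) with (t * dot (vsub w u) b - dot (vsub v u) b)
    by (coords; ring).
  replace (cross b (vsub (interp t u w) v)) with (t * cross b (vsub w u) + - cross b (vsub v u))
    by (coords; ring).
  replace (dot (vsub w (interp t u w)) b) with ((1 - t) * dot (vsub w u) b) by (coords; ring).
  replace (cross b (vsub w (interp t u w))) with ((1 - t) * cross b (vsub w u)) by (coords; ring).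
  rewrite <- Hpv, Rminus_diag, Rabs_R0.
  assert (A := Rabs_triang (t * cross b (vsub w u)) (- cross b (vsub v u))).
  rewrite Rabs_Ropp in A.
  rewrite !Rabs_mult, (Rabs_pos_eq t), (Rabs_pos_eq (1 - t)), (Rabs_pos_eq (dot (vsub w u) b)) in *
    by lra.
  lra.
Qed.

(** * Convexity of subcones and estimates inside a cone *)

Lemma angle_combination (u v w q : pt) :
  0 < orient v u w -> 0 < orient v u q -> 0 < orient u w q ->
  exists a c, 0 < a /\ 0 < c /\ vsub q u = vadd (vscale a (vsub v u)) (vscale c (vsub w u)).
Proof.
  intros HD H1 H2. exists (orient u w q / orient v u w), (orient v u q / orient v u w).
  split; [now apply Rdiv_lt_0_compat|]. split; [now apply Rdiv_lt_0_compat|].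
  assert (HN : orient v u w <> 0) by lra. clear HD H1 H2.
  coords. f_equal; field; exact HN.
Qed.

(** Subcones are convex: the side conditions are linear, and the cone condition passes to positive
    combinations by the triangle inequality. *)
Lemma in_subcone_angle (n : nat) (S : list (pt * pt)) (u : pt) (i : nat) (side : pt -> bool)
    (v w q : pt) :
  0 < cos (cone_angle n / 2) -> in_subcone n S u i side v -> in_subcone n S u i side w ->
  0 < orient v u w -> 0 < orient v u q -> 0 < orient u w q -> in_subcone n S u i side q.
Proof.
  intros Hc [Cv Sv] [Cw Sw] HD H1 H2.
  destruct (angle_combination u v w q HD H1 H2) as [a [c [Ha [Hc' E]]]].
  split.
  - unfold in_cone in *. rewrite E.
    assert (T := vnorm_add (vscale a (vsub v u)) (vscale c (vsub w u))).
    rewrite !vnorm_scale in T by lra.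
    replace (dot (vadd _ _) (bisector n i))
      with (a * dot (vsub v u) (bisector n i) + c * dot (vsub w u) (bisector n i))
      by (clear; coords; ring).
    nra.
  - intros d Hd Cd. specialize (Sv d Hd Cd). specialize (Sw d Hd Cd). rewrite E.
    replace (cross (vsub d u) (vadd _ _))
      with (a * cross (vsub d u) (vsub v u) + c * cross (vsub d u) (vsub w u))
      by (clear; coords; ring).
    destruct (side d); nra.
Qed.

(** By convexity [d] lies in the cone, so its constraint counts as a splitting one, yet it has [v]
    and [w] strictly on opposite sides. *)
Lemma subcone_unsplit (n : nat) (S : list (pt * pt)) (u : pt) (i : nat) (side : pt -> bool)
    (v w d : pt) :
  0 < cos (cone_angle n / 2) -> in_subcone n S u i side v -> in_subcone n S u i side w ->
  0 < orient v u w -> is_constraint S u d -> 0 < orient v u d -> 0 < orient u w d -> False.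
Proof.
  intros Hc Iv Iw HD Hd H1 H2.
  destruct (in_subcone_angle n S u i side v w d Hc Iv Iw HD H1 H2) as [Cd _].
  destruct Iv as [_ Sv], Iw as [_ Sw]. specialize (Sv d Hd Cd). specialize (Sw d Hd Cd).
  replace (orient v u d) with (cross (vsub d u) (vsub v u)) in H1 by (clear; coords; ring).
  replace (orient u w d) with (- cross (vsub d u) (vsub w u)) in H2 by (clear; coords; ring).
  destruct (side d); lra.
Qed.

Lemma subcone_exists (n : nat) (S : list (pt * pt)) (u : pt) (i : nat) (w : pt) :
  in_cone n u i w -> exists side, in_subcone n S u i side w.
Proof.
  intros Hw.
  exists (fun c => if Rle_dec 0 (cross (vsub c u) (vsub w u)) then true else false).
  split; [exact Hw|]. intros c _ _.
  destruct (Rle_dec 0 (cross (vsub c u) (vsub w u))); lra.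
Qed.

(** If [ab] is itself a constraint, no other constraint crosses it properly. *)
Lemma sees_uncrossed (P : list pt) (S : list (pt * pt)) (a b : pt) :
  valid_constraints P S -> sees S a b -> uncrossed S a b.
Proof.
  intros [_ HS] [H|[H|H]]; [exact H| |]; intros c Hc X.
  - exact (HS _ _ H Hc X).
  - exact (HS _ _ H Hc (proper_cross_swap_l _ _ _ _ X)).
Qed.

Lemma half_cone_trig (k : nat) : (1 <= k)%nat ->
  0 < sin (cone_angle (4 * k + 4) / 2) < cos (cone_angle (4 * k + 4) / 2).
Proof.
  intros Hk. assert (Ht := cone_angle_pos k). assert (HT := cone_angle_half_turn k).
  set (th := cone_angle (4 * k + 4)) in *.
  assert (2 <= INR (k + 1)) by (change 2 with (INR 2); apply le_INR; lia).
  assert (Hp := PI_RGT_0). assert (4 * th <= PI) by nra.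
  split; [apply sin_gt_0; lra|].
  rewrite <- sin_shift. apply sin_increasing_1; lra.
Qed.

(* In the frame of the bisector, a cone vector of length [r] at angle [psi] gives
   [cos psi - |sin psi| >= cos (theta/2) - sin (theta/2)]: this is where the constant arises. *)
Lemma in_cone_vnorm (n : nat) (u : pt) (i : nat) (v : pt) :
  0 < sin (cone_angle n / 2) < cos (cone_angle n / 2) -> in_cone n u i v ->
  0 < dot (vsub v u) (bisector n i) /\
  0 < vnorm (vsub v u) /\
  vnorm (vsub v u) * (cos (cone_angle n / 2) - sin (cone_angle n / 2))
    <= dot (vsub v u) (bisector n i) - Rabs (cross (bisector n i) (vsub v u)).
Proof.
  intros Hh Hv. unfold in_cone in Hv.
  assert (Hb : dot (bisector n i) (bisector n i) = 1) by apply cw_dir_unit.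
  assert (Hn := vnorm_ge0 (vsub v u)).
  assert (Hpy := frame_pythagoras _ (vsub v u) Hb).
  assert (Hp : 0 < dot (vsub v u) (bisector n i)) by nra.
  assert (Hr : 0 < vnorm (vsub v u)).
  { destruct Hn as [Hn|Hn]; [exact Hn|]. rewrite <- Hn in Hpy. nra. }
  split; [exact Hp|]. split; [exact Hr|].
  assert (Ht := sin2_cos2 (cone_angle n / 2)). unfold Rsqr in Ht.
  set (p := dot (vsub v u) (bisector n i)) in *.
  set (q := cross (bisector n i) (vsub v u)) in *.
  set (r := vnorm (vsub v u)) in *.
  set (co := cos (cone_angle n / 2)) in *. set (si := sin (cone_angle n / 2)) in *.
  assert (Hq : Rabs q <= r * si).
  { rewrite <- (Rabs_pos_eq (r * si)) by nra. apply Rsqr_le_abs_0. unfold Rsqr.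
    assert (0 <= r * co) by nra.
    assert (r * co * (r * co) <= p * p) by nra.
    assert (r * r * (si * si + co * co) = r * r) by (rewrite Ht; ring). nra. }
  lra.
Qed.

(** * Paths *)

Definition connected_within (E : pt -> pt -> Prop) (x y : pt) (L : R) : Prop :=
  exists l, is_path E x l y /\ path_length x l <= L.

Lemma connected_within_cat (E : pt -> pt -> Prop) (x y z : pt) (L1 L2 L : R) :
  connected_within E x y L1 -> connected_within E y z L2 -> L1 + L2 <= L ->
  connected_within E x z L.
Proof.
  intros [l [H1 B1]] [l' [H2 B2]] HL. exists (l ++ l').
  enough (is_path E x (l ++ l') z /\
    path_length x (l ++ l') = path_length x l + path_length y l') as [A B]
    by (split; [exact A|lra]).
  clear HL B1 B2. revert x H1. induction l as [|a l IH]; cbn; intros x H1.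
  - subst x. split; [exact H2|ring].
  - destruct H1 as [Ha H1]. destruct (IH a H1) as [A B]. rewrite B. split; [tauto|ring].
Qed.

Lemma connected_within_edge (E : pt -> pt -> Prop) (x y : pt) (L : R) :
  E x y -> edist x y <= L -> connected_within E x y L.
Proof. intros H HL. exists (y :: nil). cbn. split; [tauto|lra]. Qed.

(** Each chain edge is passed to the induction hypothesis in the frame of its own cone, where by
    [cone_exists] its 1-norm is at most the one in frame [i]. The chain is shorter than [M] in frame
    [i], hence so is every edge. *)
Lemma vis_chain_connected (k : nat) (P : list pt) (S : list (pt * pt)) (E : pt -> pt -> Prop)
    (i : nat) (K M : R) (v w : pt) (L : R) :
  general_position (4 * k + 4) P -> 0 < K ->
  (forall a b j, In a P -> In b P -> (j < 4 * k + 4)%nat -> a <> b -> sees S a b ->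
     in_cone (4 * k + 4) a j b -> l1 (bisector (4 * k + 4) j) (vsub b a) < M ->
     connected_within E a b (l1 (bisector (4 * k + 4) j) (vsub b a) / K)) ->
  vis_chain P S (l1 (bisector (4 * k + 4) i)) v w L -> L < M ->
  connected_within E v w (L / K).
Proof.
  intros GP HK IH H.
  induction H as [v w L Hv Hw Hne Hun HL | v p w L1 L2 L H1 IH1 H2 IH2 HL]; intros HM.
  - destruct (cone_exists k P v w GP Hv Hw Hne) as [j [Hj [Hin Hmin]]]. specialize (Hmin i).
    destruct (IH v w j) as [l [Hl Bl]]; auto; [now left|lra|].
    exists l. split; [exact Hl|]. eapply Rle_trans; [exact Bl|].
    apply Rmult_le_compat_r; [left; now apply Rinv_0_lt_compat|lra].
  - assert (G1 := vis_chain_ge0 _ _ _ _ _ _ (l1_seminorm _) H1).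
    assert (G2 := vis_chain_ge0 _ _ _ _ _ _ (l1_seminorm _) H2).
    apply connected_within_cat with (y := p) (L1 := L1 / K) (L2 := L2 / K);
      [apply IH1; lra|apply IH2; lra|].
    unfold Rdiv. rewrite <- Rmult_plus_distr_r.
    apply Rmult_le_compat_r; [left; now apply Rinv_0_lt_compat|lra].
Qed.

Lemma theta_path_step (k : nat) (P : list pt) (S : list (pt * pt)) (u w : pt) (i : nat) :
  let n := (4 * k + 4)%nat in
  let K := cos (cone_angle n / 2) - sin (cone_angle n / 2) in
  (1 <= k)%nat -> general_position n P -> valid_constraints P S ->
  In u P -> In w P -> sees S u w -> (i < n)%nat -> in_cone n u i w ->
  (forall a b j, In a P -> In b P -> (j < n)%nat -> a <> b -> sees S a b ->
     in_cone n a j b -> l1 (bisector n j) (vsub b a) < l1 (bisector n i) (vsub w u) ->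
     connected_within (theta_edge n P S) a b (l1 (bisector n j) (vsub b a) / K)) ->
  connected_within (theta_edge n P S) u w (l1 (bisector n i) (vsub w u) / K).
Proof.
  intros n K Hk GP HS Hu Hw Huw Hi Cw IH.
  assert (Trig := half_cone_trig k Hk). fold n in Trig.
  assert (Hcos : 0 < cos (cone_angle n / 2)) by lra.
  assert (HK : 0 < K) by (unfold K; lra).
  destruct (subcone_exists n S u i w Cw) as [side Sw].
  destruct (list_argmin _ P (fun v => in_subcone n S u i side v /\ sees S u v) (proj n u i))
    as [v [Hv [[Sv Huv] Hmin]]]; [now exists w|].
  assert (Edge : theta_edge n P S u v).
  { split; [exact Hu|]. split; [exact Hv|]. left. split; [exact Hv|].
    exists i. split; [exact Hi|]. exists side. split; [exact Sv|]. split; [exact Huv|].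
    intros q Hq Sq Hsq. apply Hmin; auto. }
  destruct (in_cone_vnorm n u i v Trig (proj1 Sv)) as [Pv [Rv Bv]]. fold K in Bv.
  destruct (in_cone_vnorm n u i w Trig Cw) as [Pw [Rw Bw]].
  assert (Hb : dot (bisector n i) (bisector n i) = 1) by apply cw_dir_unit.
  assert (Kdiv : forall x y, x * K <= y -> x <= y / K).
  { intros x y H. apply (Rmult_le_reg_r K); [exact HK|]. unfold Rdiv.
    rewrite Rmult_assoc, Rinv_l; lra. }
  (* If [w] itself is selected, the single edge suffices: [K |uw| <= p - |q| <= p + |q|]. *)
  destruct (classic (v = w)) as [->|Hvw].
  { apply connected_within_edge; [exact Edge|]. apply Kdiv. unfold edist, l1.
    rewrite (Rabs_pos_eq (dot _ _)) by lra.
    assert (A := Rabs_pos (cross (bisector n i) (vsub w u))). lra. }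
  assert (Hlt : dot (vsub v u) (bisector n i) < dot (vsub w u) (bisector n i)).
  { assert (A := Hmin w Hw (conj Sw Huw)). unfold proj in A.
    destruct A as [A|A]; [exact A|]. exfalso.
    apply (proj2 (proj1 GP v w Hv Hw Hvw) i Hi).
    replace (dot (bisector n i) (vsub w v))
      with (dot (vsub w u) (bisector n i) - dot (vsub v u) (bisector n i))
      by (clear; generalize (bisector n i); intros; coords; ring). lra. }
  set (t := dot (vsub v u) (bisector n i) / dot (vsub w u) (bisector n i)).
  assert (Ht : 0 < t < 1).
  { split; [now apply Rdiv_lt_0_compat|].
    apply (Rmult_lt_reg_r (dot (vsub w u) (bisector n i))); [exact Pw|].
    unfold t, Rdiv. rewrite Rmult_assoc, Rinv_l; lra. }
  assert (Et : dot (vsub v u) (bisector n i) = t * dot (vsub w u) (bisector n i))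
    by (unfold t; field; lra).
  assert (Nv := sees_uncrossed P S u v HS Huv). assert (Nw := sees_uncrossed P S u w HS Huw).
  assert (Emp : forall a c, in_subcone n S u i side a -> in_subcone n S u i side c ->
    0 < orient a u c -> empty_below P S u (bisector n i) v a c).
  { intros a c Sa Sc Hac. split.
    - intros d. now apply (subcone_unsplit n S u i side a c d).
    - intros q Hq Nq H1 H2. apply (Hmin q Hq). split; [|now left].
      now apply (in_subcone_angle n S u i side a c q). }
  assert (Chain := first_vertex_chain P S u v w (bisector n i) t (proj2 GP) HS Hu Hv Hw Hb Ht Pw Et
    Hvw Nv Nw (Emp v w Sv Sw) (Emp w v Sw Sv)).
  assert (Len := detour_l1 u v w (bisector n i) t Ht Pw Et).
  set (L := l1 _ _ + l1 _ (vsub w _)) in *.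
  (* With [Len] and [Bv], [K |uv| + L] is at most the 1-norm of [w - u]; positivity of the first
     term makes [L] strictly smaller, as the induction requires. *)
  assert (0 < vnorm (vsub v u) * K) by nra.
  apply connected_within_cat with (y := v) (L1 := edist u v) (L2 := L / K).
  - apply connected_within_edge; [exact Edge|lra].
  - apply (vis_chain_connected k P S _ i K (l1 (bisector n i) (vsub w u))); auto. lra.
  - unfold edist. apply Rle_trans with ((vnorm (vsub v u) * K + L) / K);
      [right; field; lra|].
    apply Rmult_le_compat_r; [left; now apply Rinv_0_lt_compat|lra].
Qed.

Lemma theta_path (k : nat) (P : list pt) (S : list (pt * pt)) (u w : pt) (i : nat) :
  let n := (4 * k + 4)%nat in
  (1 <= k)%nat -> general_position n P -> valid_constraints P S ->
  In u P -> In w P -> sees S u w -> (i < n)%nat -> in_cone n u i w ->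
  connected_within (theta_edge n P S) u w
    (l1 (bisector n i) (vsub w u) / (cos (cone_angle n / 2) - sin (cone_angle n / 2))).
Proof.
  intros n Hk GP HS Hu Hw Huw Hi Cw.
  assert (Mem : forall a b j, In ((a, b), j) (list_prod (list_prod P P) (seq 0 n)) <->
    In a P /\ In b P /\ (j < n)%nat).
  { intros a b j. rewrite !in_prod_iff, in_seq. intuition lia. }
  (* The induction runs over triples of two vertices and a cone index, ordered by the 1-norm in the
     frame of that cone. *)
  assert (All := list_measure_ind _ (list_prod (list_prod P P) (seq 0 n))
    (fun x => l1 (bisector n (snd x)) (vsub (snd (fst x)) (fst (fst x))))
    (fun x => sees S (fst (fst x)) (snd (fst x)) ->
       in_cone n (fst (fst x)) (snd x) (snd (fst x)) ->
       connected_within (theta_edge n P S) (fst (fst x)) (snd (fst x))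
         (l1 (bisector n (snd x)) (vsub (snd (fst x)) (fst (fst x)))
          / (cos (cone_angle n / 2) - sin (cone_angle n / 2))))).
  apply (fun H => All H ((u, w), i)); [|now apply Mem|exact Huw|exact Cw].
  clear - Hk GP HS Mem. intros [[u w] i] Hin IH Huw Cw. cbn [fst snd] in *.
  apply Mem in Hin. destruct Hin as [Hu [Hw Hi]].
  apply theta_path_step; auto.
  intros a b j Ha Hb Hj _ Hab Cab Hlt.
  apply (IH ((a, b), j)); auto. now apply Mem.
Qed.

(** * The canonical triangle and the stated bound *)

(** The boundary directions are mirror images in the bisector: in the midpoint their sine parts
    cancel, and the cosine of the half angle cancels the denominator. *)
Lemma canon_mid_offset (n : nat) (u : pt) (i : nat) (w : pt) :
  cos (cone_angle n / 2) <> 0 ->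
  vsub (canon_mid n u i w) u = vscale (dot (vsub w u) (bisector n i)) (bisector n i).
Proof.
  intros H. unfold canon_mid, midpoint, canon_corner1, canon_corner2, bnd_dir1, bnd_dir2, proj.
  set (p := dot (vsub w u) (bisector n i)). unfold bisector.
  unfold vsub, vscale, vadd, cw_dir; cbn [fst snd].
  rewrite sin_minus, cos_minus, sin_plus, cos_plus. f_equal; field; exact H.
Qed.

(** The vector from [u] to the midpoint is a positive multiple of the bisector, so [alpha] is
    measured from the bisector. As [acos] has nonnegative sine, the coordinate across appears in
    absolute value. *)
Lemma canon_angle (n : nat) (u : pt) (i : nat) (w : pt) :
  0 < sin (cone_angle n / 2) < cos (cone_angle n / 2) -> in_cone n u i w ->
  let alpha := vangle (vsub w u) (vsub (canon_mid n u i w) u) in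
  cos alpha * vnorm (vsub w u) = dot (vsub w u) (bisector n i) /\
  sin alpha * vnorm (vsub w u) = Rabs (cross (bisector n i) (vsub w u)).
Proof.
  intros Hh Cw alpha. destruct (in_cone_vnorm n u i w Hh Cw) as [Hp [Hr _]].
  assert (Hb : dot (bisector n i) (bisector n i) = 1) by apply cw_dir_unit.
  unfold alpha, vangle. rewrite canon_mid_offset by lra.
  rewrite vnorm_scale by lra.
  assert (Hpy := frame_pythagoras _ (vsub w u) Hb).
  replace (dot (vsub w u) (vscale _ (bisector n i)))
    with (dot (vsub w u) (bisector n i) * dot (vsub w u) (bisector n i))
    by (clear; generalize (bisector n i); intros; coords; ring).
  replace (vnorm (bisector n i)) with 1 by (unfold vnorm; rewrite Hb, sqrt_1; reflexivity).
  set (p := dot (vsub w u) (bisector n i)) in *.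
  set (q := cross (bisector n i) (vsub w u)) in *.
  set (r := vnorm (vsub w u)) in *.
  replace (p * p / (r * (p * 1))) with (p / r) by (field; lra).
  assert (Hx : -1 <= p / r <= 1).
  { split; apply (Rmult_le_reg_r r); try exact Hr; unfold Rdiv;
      rewrite Rmult_assoc, Rinv_l; nra. }
  rewrite cos_acos, sin_acos by exact Hx. split; [field; lra|].
  replace (1 - (p / r)²) with ((q / r)²).
  - rewrite sqrt_Rsqr_abs. unfold Rdiv. rewrite Rabs_mult, Rabs_inv, (Rabs_pos_eq r) by lra.
    field; lra.
  - unfold Rsqr. apply (Rmult_eq_reg_l (r * r)); [|nra]. field_simplify; lra.
Qed.

Theorem theorem3 :
  forall (k : nat) (P : list pt) (S : list (pt * pt)) (u w : pt) (i : nat),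
    (1 <= k)%nat ->
    NoDup P ->
    general_position (4 * k + 4) P ->
    valid_constraints P S ->
    In u P -> In w P -> u <> w ->
    sees S u w ->
    (i < 4 * k + 4)%nat ->
    in_cone (4 * k + 4) u i w ->
    let theta := cone_angle (4 * k + 4) in
    let m := canon_mid (4 * k + 4) u i w in
    let alpha := vangle (vsub w u) (vsub m u) in
    exists l : list pt,
      is_path (theta_edge (4 * k + 4) P S) u l w /\
      path_length u l <=
        (cos alpha / cos (theta / 2)
         + (cos alpha * tan (theta / 2) + sin alpha)
           / (cos (theta / 2) - sin (theta / 2))) * edist u w.
Proof.
  intros k P S u w i Hk _ GP HS Hu Hw _ Huw Hi Cw theta m alpha.
  assert (Trig := half_cone_trig k Hk). fold theta in Trig.
  destruct (theta_path k P S u w i Hk GP HS Hu Hw Huw Hi Cw) as [l [Hl Bl]].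
  exists l. split; [exact Hl|]. fold theta in Bl.
  destruct (canon_angle _ u i w Trig Cw) as [Ec Es]. fold m in Ec, Es. fold alpha in Ec, Es.
  destruct (in_cone_vnorm _ u i w Trig Cw) as [Hp _].
  (* With [c] and [s] the cosine and sine of [theta / 2], [1 / c + (s / c) / (c - s) = 1 / (c - s)],
     so the stated factor equals [(cos alpha + sin alpha) / (c - s)]. *)
  eapply Rle_trans; [exact Bl|]. right. unfold l1.
  rewrite (Rabs_pos_eq (dot _ _)), <- Ec, <- Es by lra.
  unfold edist, tan. field. lra.
Qed.
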